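(* Let $(\Omega,\mathcal F)$ be a measurable space, let $\mathcal C\subset\mathcal F$ be a sub-$\sigma$-algebra, let $\rho:\mathbb F\to\mathbb R$ be a sublinear operator, and let $\xi\in\mathbb F$. Suppose $\inf_{\eta\in\mathbb C}\rho\big((\xi-\eta)^2\big)>0$. Then $\hat\eta\in\mathbb C$ satisfies $$\rho\big((\xi-\hat\eta)^2\big)=\inf_{\eta\in\mathbb C}\rho\big((\xi-\eta)^2\big)$$ if and only if $\hat\eta$ is a bounded $\mathcal C$-measurable solution of the equation $$\inf_{\eta\in\mathbb C}\rho\big((\xi-\hat\eta)(\xi-\eta)\big)=\rho\big((\xi-\hat\eta)^2\big).$$
   Context: $\mathbb F$ denotes the set of all bounded $\mathcal F$-measurable real functions on $\Omega$ and $\mathbb C$ the set of all bounded $\mathcal C$-measurable real functions. A sublinear operator is a functional $\rho:\mathbb F\to\mathbb R$ such that: (i) $\rho(\xi_1)\ge\rho(\xi_2)$ if $\xi_1\ge\xi_2$; (ii) $\rho(c)=c$ for $c\in\mathbb R$; (iii) $\rho(\xi_1+\xi_2)\le\rho(\xi_1)+\rho(\xi_2)$ for all $\xi_1,\xi_2\in\mathbb F$; (iv) $\rho(\lambda\xi)=\lambda\rho(\xi)$ for $\lambda\ge0$. No continuity of $\rho$ is assumed. *)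

(* Defs.v *)
From HB Require Import structures.
From mathcomp Require Import all_boot all_order all_algebra.
From mathcomp Require Import all_classical all_reals all_analysis.

Set Implicit Arguments.
Unset Strict Implicit.
Unset Printing Implicit Defensive.

Import Order.TTheory GRing.Theory Num.Theory.
Import numFieldNormedType.Exports.

Local Open Scope classical_set_scope.
Local Open Scope ring_scope.

Definition bounded_measurable (R : realType) (d : measure_display)
    (T : measurableType d) : set (T -> R) :=
  [set f : T -> R | measurable_fun [set: T] f /\ bounded_fun f].
Arguments bounded_measurable R {d} T.

(* [g_sigma_algebraType C] is [T] equipped with the sigma-algebra generated by
   [C], which is [C] itself when [C] is a sigma-algebra. *)
Definition bounded_measurable_wrt (R : realType) (d : measure_display)
    (T : measurableType d) (C : set (set T)) : set (T -> R) :=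
  bounded_measurable R (g_sigma_algebraType C).
Arguments bounded_measurable_wrt R {d T} C.

(* A sublinear operator is a functional on bounded measurable functions; it is
   represented by a total [rho], whose values on other functions are
   unconstrained. *)
Definition sublinear_operator (R : realType) (d : measure_display)
    (T : measurableType d) (rho : (T -> R) -> R) : Prop :=
  [/\ forall f g : T -> R,
        bounded_measurable R T f -> bounded_measurable R T g ->
        (forall x, g x <= f x) -> rho g <= rho f,
      forall c : R, rho (cst c) = c,
      forall f g : T -> R,
        bounded_measurable R T f -> bounded_measurable R T g ->
        rho (f \+ g) <= rho f + rho g
    & forall (l : R) (f : T -> R),
        0 <= l -> bounded_measurable R T f ->
        rho (l \*o f) = l * rho f].

(* Main.v *)
Require Import Defs.
From HB Require Import structures.
From mathcomp Require Import all_boot all_order all_algebra.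
From mathcomp Require Import all_classical all_reals all_analysis.
From mathcomp Require Import measurable_realfun ring lra.
Import Order.TTheory GRing.Theory Num.Theory.
Import numFieldNormedType.Exports.
Local Open Scope classical_set_scope.
Local Open Scope ring_scope.

(** Write [X = xi - etah] and [Y = xi - eta]; as [eta] runs through the
    [C]-measurable bounded functions, [Y] runs through a convex set containing
    [X]. Since both infima contain the value [rho (X ^+ 2)] (take
    [eta = etah]), each of the two equations says that [rho (X ^+ 2)] is a
    lower bound ([inf_eq_attained]). The theorem is therefore the statement
    that [rho (X ^+ 2) <= rho (Y ^+ 2)] for all [Y] if and only if
    [rho (X ^+ 2) <= rho (X * Y)] for all [Y]: a minimiser of a convex
    functional is characterised by its first-order condition.

    From the first-order condition to minimality, [X * Y] is at most the mean
    of [X ^+ 2] and [Y ^+ 2], and this inequality survives [rho]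
    ([sublinear_cross_le]).

    Conversely, let [X] be a minimiser and move from [X] towards [Y] by the
    convex combination [(1 - t) X + t Y]. Expanding its square gives
    coefficients that are all nonnegative for [t] in [0, 1], so subadditivity
    and positive homogeneity bound its image under [rho] by the quadratic
    [(1 - t) ^+ 2 * rho (X ^+ 2) + 2 t (1 - t) * rho (X * Y)
    + t ^+ 2 * rho (Y ^+ 2)] ([sublinear_sqr_conv_le]). This is at least
    [rho (X ^+ 2)] by minimality; comparing the terms of order [t] at [0]
    gives [rho (X ^+ 2) <= rho (X * Y)] ([first_order_le]). The sign of the
    coefficients replaces the linearity of an expectation, and the limit
    [t -> 0] is taken in a real quadratic rather than under [rho]. *)

Lemma bounded_funP {R : realType} {T : Type} (f : T -> R) :
  bounded_fun f <-> exists M, forall x, `|f x| <= M.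
Proof.
split=> [[M [_ fM]]|[M fM]].
  by exists (M + 1) => x; apply: fM; rewrite ?ltrDl.
exists M; split; first exact: num_real.
by move=> N MN x _; rewrite /= (le_trans (fM x))// ltW.
Qed.

Section bounded_measurable_closure.
Context {R : realType} {d : measure_display} {T : measurableType d}.
Implicit Types f g : T -> R.

Lemma bounded_measurable_cst (c : R) : bounded_measurable R T (cst c).
Proof. by split; [exact: measurable_cst|apply/bounded_funP; exists `|c| => x]. Qed.

Lemma bounded_measurableD f g : bounded_measurable R T f ->
  bounded_measurable R T g -> bounded_measurable R T (f \+ g).
Proof.
move=> [mf /bounded_funP[M fM]] [mg /bounded_funP[N gN]]; split.
  exact: measurable_funD.
by apply/bounded_funP; exists (M + N) => x;
  rewrite (le_trans (ler_normD _ _))// lerD.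
Qed.

Lemma bounded_measurableM f g : bounded_measurable R T f ->
  bounded_measurable R T g -> bounded_measurable R T (f \* g).
Proof.
move=> [mf /bounded_funP[M fM]] [mg /bounded_funP[N gN]]; split.
  exact: measurable_funM.
by apply/bounded_funP; exists (M * N) => x; rewrite /= normrM ler_pM.
Qed.

Lemma bounded_measurableZ (c : R) f : bounded_measurable R T f ->
  bounded_measurable R T (c \*o f).
Proof. by move=> bf; exact: bounded_measurableM (bounded_measurable_cst c) bf. Qed.

Lemma bounded_measurableB f g : bounded_measurable R T f ->
  bounded_measurable R T g -> bounded_measurable R T (fun x => f x - g x).
Proof.
move=> bf /(bounded_measurableZ (-1))/(bounded_measurableD _ _ bf).
by congr bounded_measurable; apply/funext => x /=; rewrite mulN1r.
Qed.

End bounded_measurable_closure.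

Lemma bounded_measurable_wrt_sub {R : realType} {d : measure_display}
    {T : measurableType d} (C : set (set T)) : C `<=` measurable ->
  bounded_measurable_wrt R C `<=` bounded_measurable R T.
Proof.
move=> Cm f [mf bf]; split=> // _ B mB.
have /smallest_sub : sigma_algebra [set: T] (@measurable d T).
  exact: sigma_algebra_measurable.
by move=> /(_ C Cm); apply; apply: mf.
Qed.

Section sublinear.
Context {R : realType} {d : measure_display} {T : measurableType d}.
Context (rho : (T -> R) -> R) (rho_sub : sublinear_operator rho).
Implicit Types X Y : T -> R.

Lemma sublinear_comb_le (a b : R) X Y : 0 <= a -> 0 <= b ->
  bounded_measurable R T X -> bounded_measurable R T Y ->
  rho (a \*o X \+ b \*o Y) <= a * rho X + b * rho Y.
Proof.
move=> a0 b0 bX bY; case: rho_sub => _ _ rhoD rhoZ.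
by rewrite -!rhoZ// rhoD//; exact: bounded_measurableZ.
Qed.

(** The pointwise bound is [(X - Y) ^+ 2 >= 0]; monotonicity carries it
    through [rho], and both weights are nonnegative. *)
Lemma sublinear_cross_le X Y :
  bounded_measurable R T X -> bounded_measurable R T Y ->
  rho (X \* Y) <= 2^-1 * rho (X \* X) + 2^-1 * rho (Y \* Y).
Proof.
move=> bX bY; case: rho_sub => rho_le _ _ _.
apply: le_trans (sublinear_comb_le _ _ _ _ _ _ _ _) => //.
- apply: rho_le => [||x /=].
  + by apply: bounded_measurableD; apply/bounded_measurableZ/bounded_measurableM.
  + exact: bounded_measurableM.
  + have := sqr_ge0 (X x - Y x); nra.
- exact: bounded_measurableM.
- exact: bounded_measurableM.
Qed.

(** The cross term enters with the coefficient [2 t (1 - t)]; restricting [t]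
    to [0, 1] keeps it nonnegative, as positive homogeneity requires. *)
Lemma sublinear_sqr_conv_le (t : R) X Y : 0 <= t <= 1 ->
  bounded_measurable R T X -> bounded_measurable R T Y ->
  rho (fun x => ((1 - t) * X x + t * Y x) ^+ 2) <=
  (1 - t) ^+ 2 * rho (X \* X) + 2 * t * (1 - t) * rho (X \* Y)
  + t ^+ 2 * rho (Y \* Y).
Proof.
move=> /andP[t0 t1] bX bY.
have bXX := bounded_measurableM _ _ bX bX.
have bXY := bounded_measurableM _ _ bX bY.
have bYY := bounded_measurableM _ _ bY bY.
have c0 : 0 <= 2 * t * (1 - t) by rewrite !mulr_ge0// subr_ge0.
pose Z := ((1 - t) ^+ 2 \*o (X \* X)) \+ ((2 * t * (1 - t)) \*o (X \* Y)).
have -> : (fun x => ((1 - t) * X x + t * Y x) ^+ 2)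
        = (1 \*o Z) \+ (t ^+ 2 \*o (Y \* Y)).
  by apply/funext => x /=; rewrite /Z /=; ring.
have bZ : bounded_measurable R T Z.
  by apply: bounded_measurableD; exact: bounded_measurableZ.
apply: le_trans (sublinear_comb_le _ _ _ _ ler01 (sqr_ge0 t) bZ bYY) _.
by rewrite mul1r lerD2r sublinear_comb_le// sqr_ge0.
Qed.

End sublinear.

(** The derivative at [0] of the right-hand side is [2 (b - a)], which cannot
    be negative if the right-hand side is minimal at [t = 0]. *)
Lemma first_order_le {R : realFieldType} (a b e : R) :
  (forall t, 0 <= t <= 1 ->
    a <= (1 - t) ^+ 2 * a + 2 * t * (1 - t) * b + t ^+ 2 * e) ->
  a <= b.
Proof.
move=> min; rewrite leNgt; apply/negP => ltba.
(* After division by t, the hypothesis reads 2 (a - b) <= t (a - 2 b + e);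
   this t makes the right-hand side at most a - b. *)
pose k := `|a - 2 * b + e|; pose t := (a - b) / (a - b + k).
have k0 : 0 <= k by exact: normr_ge0.
have M0 : 0 < a - b + k by lra.
have tM : t * (a - b + k) = a - b by rewrite divfK ?gt_eqF.
have t0 : 0 < t by rewrite divr_gt0// subr_gt0.
have t1 : t <= 1 by rewrite ler_pdivrMr//; lra.
have := min t; rewrite (ltW t0) t1 => /(_ isT) at_t.
have : t * (2 * (a - b)) <= t * (t * (a - 2 * b + e)).
  rewrite -subr_ge0 in at_t; rewrite -subr_ge0.
  by apply: le_trans at_t _; rewrite le_eqVlt; apply/orP; left; apply/eqP; ring.
rewrite ler_pM2l// => slope.
have : t * (a - 2 * b + e) <= t * (a - b + k).
  rewrite ler_pM2l//; have := ler_norm (a - 2 * b + e); rewrite -/k; lra.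
lra.
Qed.

Lemma inf_eq_attained {R : realType} {I : Type} (S : set I) (F : I -> R)
    (i : I) : S i ->
  (F i)%:E = ereal_inf [set (F j)%:E | j in S] <->
  forall j, S j -> F i <= F j.
Proof.
move=> Si; split=> [Fi j Sj|Fi].
  by rewrite -lee_fin Fi; apply: ereal_inf_lbound; exists j.
apply/le_anti/andP; split.
  by apply: le_ereal_inf_tmp => _ [j Sj <-]; rewrite lee_fin Fi.
by apply: ereal_inf_lbound; exists i.
Qed.

Theorem theorem4p6 (R : realType) (d : measure_display) (T : measurableType d)
    (C : set (set T)) (rho : (T -> R) -> R) (xi : T -> R) :
  sigma_algebra [set: T] C ->
  C `<=` measurable ->
  sublinear_operator rho ->
  bounded_measurable R T xi ->
  (0 < ereal_inf [set (rho (fun x => (xi x - eta x) ^+ 2))%:E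
                 | eta in bounded_measurable_wrt R C])%E ->
  forall etah : T -> R,
    (bounded_measurable_wrt R C etah /\
     (rho (fun x => (xi x - etah x) ^+ 2))%:E =
     ereal_inf [set (rho (fun x => (xi x - eta x) ^+ 2))%:E
               | eta in bounded_measurable_wrt R C])
    <->
    (bounded_measurable_wrt R C etah /\
     ereal_inf [set (rho (fun x => (xi x - etah x) * (xi x - eta x)))%:E
               | eta in bounded_measurable_wrt R C] =
     (rho (fun x => (xi x - etah x) ^+ 2))%:E).
Proof.
move=> _ Cm rho_sub bxi _ etah.
have sqrE (f : T -> R) : (fun x => f x ^+ 2) = f \* f.
  by apply/funext => x; rewrite expr2.
have bdiff eta : bounded_measurable_wrt R C eta ->
    bounded_measurable R T (fun x => xi x - eta x).
  move=> Ceta; apply: bounded_measurableB bxi _.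
  exact: bounded_measurable_wrt_sub Cm _ Ceta.
pose X := fun x => xi x - etah x.
split=> -[Ch opt]; split=> //; have bX := bdiff _ Ch.
- have min := (inf_eq_attained _ _ _ Ch).1 opt.
  apply/esym/(inf_eq_attained _
    (fun eta => rho (fun x => (xi x - etah x) * (xi x - eta x))) _ Ch).
  move=> eta Ceta; have bY := bdiff _ Ceta.
  apply: (@first_order_le _ _ _ (rho (fun x => (xi x - eta x) ^+ 2))) => t t01.
  have Cz : bounded_measurable_wrt R C (((1 - t) \*o etah) \+ (t \*o eta)).
    by apply: bounded_measurableD; exact: bounded_measurableZ.
  apply: le_trans (min _ Cz) _.
  rewrite (_ : (fun x => (xi x - _) ^+ 2)
             = fun x => ((1 - t) * X x + t * (xi x - eta x)) ^+ 2).
    exact: sublinear_sqr_conv_le.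
  by apply/funext => x; rewrite /X /=; ring.
- have first_order := (inf_eq_attained _
    (fun eta => rho (fun x => (xi x - etah x) * (xi x - eta x))) _ Ch).1 (esym opt).
  apply/(inf_eq_attained _
    (fun eta => rho (fun x => (xi x - eta x) ^+ 2)) _ Ch) => eta Ceta.
  have := le_trans (first_order _ Ceta)
    (sublinear_cross_le _ rho_sub _ _ bX (bdiff _ Ceta)).
  rewrite !sqrE; set a := rho _; set b := rho _; lra.
Qed.
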